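(* Let $L>0$, let $N>1$ be an integer, and let $h\in(0,1]$. Let $f$ be any convex $L$-smooth function with minimizer $x_\star$, let $x_0$ be any initial point, $D=\|x_0-x_\star\|$, and let $x_1,\dots,x_N$ be produced by gradient descent with constant stepsizes $h_k=h$. Let $\gamma\approx0.5772$ be the Euler–Mascheroni constant. With $$c=1-\frac1{4N}+\sqrt{\frac1{16N^2}+\frac1{(2N+1)\left(\log N+\frac1{2N}+\gamma\right)}},$$ the point $x_\sigma=x_0+c(x_N-x_0)$ satisfies $$f(x_\sigma)-f(x_\star)\le\frac{LD^2}{4Nh+\left(\sqrt{1+\frac{16N^2}{(2N+1)\left(\log N+\frac1{2N}+\gamma\right)}}-1\right)h+2}.$$ Moreover, with instead $c=1+\frac1{4\sqrt{N\log N}}$, the point $x_\sigma=x_0+c(x_N-x_0)$ satisfies $$f(x_\sigma)-f(x_\star)\le\frac{LD^2}{4Nh+\sqrt{\frac N{\log N}}\,h+2}.$$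
   Context: Functions are $f:\mathbb R^d\to\mathbb R$ ($d\ge1$), with the Euclidean norm; $f$ is $L$-smooth if it is differentiable with $L$-Lipschitz gradient. Gradient descent from $x_0$ with stepsizes $h_k$ is $x_{k+1}=x_k-\frac{h_k}{L}\nabla f(x_k)$, $k=0,\dots,N-1$. $\log$ is the natural logarithm. *)

(* Defs.v *)
From mathcomp Require Import all_boot all_order all_algebra.
From mathcomp Require Import all_classical all_reals all_analysis.

Set Implicit Arguments.
Unset Strict Implicit.
Unset Printing Implicit Defensive.

Import Order.TTheory GRing.Theory Num.Theory.
Import numFieldNormedType.Exports.

Local Open Scope classical_set_scope.
Local Open Scope ring_scope.

(* The library norm `|x| on 'rV[R]_d is the max-norm, hence this definition. *)
Definition enorm (R : realType) (d : nat) (x : 'rV[R]_d) : R :=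
  Num.sqrt (\sum_(i < d) x 0 i ^+ 2).

(* The row of partial derivatives; it represents the differential 'd f x
   only when f is differentiable at x. *)
Definition grad (R : realType) (d : nat) (f : 'rV[R]_d -> R) (x : 'rV[R]_d) :
    'rV[R]_d :=
  \row_(i < d) 'D_(delta_mx 0 i) f x.

Definition smooth (R : realType) (d : nat) (L : R) (f : 'rV[R]_d -> R) : Prop :=
  (forall x, differentiable f x) /\
  (forall x y, enorm (grad f x - grad f y) <= L * enorm (x - y)).

Definition is_minimizer (R : realType) (d : nat) (f : 'rV[R]_d -> R)
    (xstar : 'rV[R]_d) : Prop :=
  forall x, f xstar <= f x.

Definition gradient_descent (R : realType) (d : nat) (L : R)
    (f : 'rV[R]_d -> R) (N : nat) (h : nat -> R) (x : nat -> 'rV[R]_d) : Prop :=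
  forall k : nat, (k < N)%N -> x k.+1 = x k - (h k / L) *: grad f (x k).

(* series harmonic n = 1 + 1/2 + ... + 1/n *)
Definition euler_mascheroni (R : realType) : R :=
  lim ((fun n : nat => series (@harmonic R) n - ln (n%:R : R)) @ \oo).

(* Main.v *)
(* In the units L = 1, interpolation inequalities for a convex 1-smooth function
   are summed with nonnegative weights, over the points x_0, .., x_(N-1),
   x_N := x_sigma: weight mu_k on the pair (xstar, x_k) and weight lambda_k on the
   pair (x_(k-1), x_k).  With tau = 2 N c + 1 and lambda_k = c k / (tau - k),
   mu_k = lambda_(k+1) - lambda_k, the function values telescope to
   f(x_sigma) - f(xstar), and the bound reduces to nonnegativity of a quadratic
   form in the gradients.  That form is affine in h and at h = 0 it is Jensen's
   inequality, so only h = 1 matters.  There, in the variables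
   Z_k = sum_(i<k) g_i + (tau - k) g_N - tau sum_j mu_j g_j, it becomes tridiagonal:
     Z_0^2 / tau + sum_(k<N) mu_k (Z_(k+1)^2 - Z_k^2)
                 + (lambda_k + lambda_(k+1)) (Z_(k+1) - Z_k)^2,
   and a Riccati recursion solved in closed form shows that it is nonnegative when
   (1 + 2 N e) e sum_(k<N) tau / ((2k+1) tau - 2k(k+1)) <= 1 with e = c - 1.
   The k-th term is at most (2N+1) / (2N(k+1)), so it suffices that
   (e + 2 N e^2) (2N+1) H_N <= 2N, where H_N is the harmonic number; the two values
   of c satisfy this because H_N <= ln N + 1/(2N) + gamma and H_N <= 1 + ln N. *)

Require Import Defs.
From mathcomp Require Import all_boot all_order all_algebra.
From mathcomp Require Import all_classical all_reals all_analysis.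
From mathcomp Require Import ring lra.

Set Implicit Arguments.
Unset Strict Implicit.
Unset Printing Implicit Defensive.

Import Order.TTheory GRing.Theory Num.Theory.
Import numFieldNormedType.Exports.

Local Open Scope classical_set_scope.
Local Open Scope ring_scope.

(** * Multipliers, the tridiagonal form and its Riccati recursion *)

Section Multipliers.
Variables (R : realFieldType) (N : nat) (c : R).
Hypothesis c_ge1 : 1 <= c.

(* [chain k] is lambda_k and [src k] is mu_k for k < N; mu_N is [1 - chain N]. *)
Definition tau : R := 2 * N%:R * c + 1.
Definition gap (k : nat) : R := tau - k%:R.
Definition chain (k : nat) : R := c * k%:R / gap k.
Definition src (k : nat) : R := c * tau / (gap k * gap k.+1).
Definition pivot (k : nat) : R := (2 * k%:R + 1) * tau - 2 * k%:R * (k%:R + 1).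
(* [gap k * ratio k] is the positive solution of the second-order recurrence
   attached to the tridiagonal form, obtained from the solution [gap] by reduction
   of order; [riccati] is the corresponding solution of the Riccati recursion,
   normalised so that [riccati N = 0]. *)
Definition ratio (k : nat) : R :=
  1 / (1 + 2 * N%:R * (c - 1)) + \sum_(k <= j < N) 1 / pivot j.
Definition riccati (k : nat) : R :=
  c / gap k ^+ 2 * (tau - 2 * k%:R - 1 / ratio k).

Lemma overshoot_gt0 : 0 < 1 + 2 * N%:R * (c - 1).
Proof. by rewrite ltr_pwDl // !mulr_ge0 ?subr_ge0. Qed.

Lemma tau_ge : 2 * N%:R + 1 <= tau.
Proof. by rewrite /tau lerD2r ler_peMr // mulr_ge0. Qed.

Lemma gap_gt0 k : (k <= N)%N -> 0 < gap k.
Proof.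
rewrite -(ler_nat R) /gap => kN; have := tau_ge.
have : 0 <= k%:R :> R by []; lra.
Qed.

Lemma gapS k : gap k.+1 = gap k - 1.
Proof. by rewrite /gap -natr1; ring. Qed.

Lemma pivot_ge k : (k < N)%N ->
  2 * N%:R * (k%:R + 1) * tau <= (2 * N%:R + 1) * pivot k.
Proof.
rewrite /pivot -(ler_nat R) -natr1 => kN; have := tau_ge.
have : 0 <= k%:R :> R by [].
set x : R := k%:R in kN *; set n : R := N%:R in kN * => x0 tn.
rewrite -subr_ge0.
(* The difference is affine in [tau]. Expanded around the lower bound of [tau_ge], its slope and,
   since [k < N], its constant term are nonnegative. *)
have -> : (2 * n + 1) * ((2 * x + 1) * tau - 2 * x * (x + 1))
    - 2 * n * (x + 1) * tau
  = (2 * n * x + 2 * x + 1) * (tau - (2 * n + 1))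
    + (2 * n + 1) * (2 * x * (n - (x + 1)) + 2 * x + 1) by ring.
have h1 : 0 <= x * (n - (x + 1)) by apply: mulr_ge0; lra.
have h2 : 0 <= n * x by apply: mulr_ge0; lra.
apply: addr_ge0; apply: mulr_ge0; lra.
Qed.

Lemma pivot_gt0 k : (k < N)%N -> 0 < pivot k.
Proof.
move=> kN; have := pivot_ge kN; have := tau_ge.
have : 1 <= N%:R :> R by rewrite ler1n (leq_ltn_trans _ kN).
set n : R := N%:R; have : 0 <= k%:R :> R by [].
set x : R := k%:R => x0 n1 tn h.
have : 0 < 2 * n * (x + 1) * tau by rewrite !mulr_gt0 //; lra.
move=> h3; have : 0 < (2 * n + 1) * pivot k by lra.
by rewrite pmulr_rgt0 //; lra.
Qed.

Lemma ratio_gt0 k : 0 < ratio k.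
Proof.
apply: ltr_pwDl; first by rewrite div1r invr_gt0 overshoot_gt0.
rewrite big_nat_cond; apply: sumr_ge0 => j; rewrite andbT => /andP[_ jN].
by apply: divr_ge0 => //; apply/ltW/pivot_gt0.
Qed.

Lemma ratioS k : (k < N)%N -> ratio k = ratio k.+1 + 1 / pivot k.
Proof. by move=> kN; rewrite /ratio big_ltn //; ring. Qed.

Lemma chain0 : chain 0 = 0.
Proof. by rewrite /chain mulr0 mul0r. Qed.

Lemma chainS k : (k < N)%N -> chain k.+1 = chain k + src k.
Proof.
move=> kN; rewrite /chain /src gapS.
have := gap_gt0 (ltnW kN); have := gap_gt0 kN; rewrite gapS /gap -natr1 => h1 h2.
by field; rewrite !gt_eqF.
Qed.

Lemma riccatiN : riccati N = 0.
Proof.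
have h := overshoot_gt0; rewrite /riccati /ratio big_geq // addr0.
suff -> : tau - 2 * N%:R - 1 / (1 / (1 + 2 * N%:R * (c - 1))) = 0 by rewrite mulr0.
by rewrite /tau; field; rewrite gt_eqF.
Qed.

(** The slack is a perfect square, zero when [a] and [b] follow the solution [gap k * ratio k].
    Summed over [k], the left side telescopes and leaves only a multiple of the initial square. *)
Lemma riccati_step k (a b : R) : (k < N)%N ->
  riccati k.+1 * b ^+ 2 - riccati k * a ^+ 2 <=
  src k * (b ^+ 2 - a ^+ 2) + (chain k + chain k.+1) * (b - a) ^+ 2.
Proof.
move=> kN.
have p0 := gap_gt0 (ltnW kN); have p1 := gap_gt0 kN.
have q0 := pivot_gt0 kN; have z0 := ratio_gt0 k; have z1 := ratio_gt0 k.+1.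
have rS := ratioS kN.
rewrite -subr_ge0.
suff -> : src k * (b ^+ 2 - a ^+ 2) + (chain k + chain k.+1) * (b - a) ^+ 2
    - (riccati k.+1 * b ^+ 2 - riccati k * a ^+ 2) =
  c * pivot k * ratio k.+1 * ratio k *
  (a / (gap k * ratio k) - b / (gap k.+1 * ratio k.+1)) ^+ 2.
  rewrite mulr_ge0 ?sqr_ge0 // !mulr_ge0 ?(ltW q0) ?(ltW z0) ?(ltW z1) //.
  exact: le_trans ler01 c_ge1.
have piv : pivot k = k%:R * (gap k - 1) + (k%:R + 1) * gap k.
  by rewrite /pivot /gap; ring.
have tauE : tau = gap k + k%:R by rewrite /gap; ring.
have s : chain k + chain k.+1 = c * pivot k / (gap k * (gap k - 1)).
  rewrite piv /chain gapS -natr1; rewrite gapS in p1.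
  by field; rewrite !gt_eqF.
rewrite s /riccati /src gapS rS in p1 *; rewrite tauE.
have zq : 0 < ratio k.+1 * pivot k + 1 by rewrite addr_gt0 // mulr_gt0.
move: (ratio k.+1) z1 zq => z z1 zq.
rewrite -natr1; move: piv q0 zq; move: (pivot k) => q -> q0 zq.
by field; rewrite !gt_eqF.
Qed.

(** Lets the term Z_0^2 / tau absorb what the telescoping leaves at 0. Clearing [ratio 0] turns the
    claim into [key], a rearrangement of the hypothesis. *)
Lemma riccati0 :
  (1 + 2 * N%:R * (c - 1)) * (c - 1) * (\sum_(0 <= j < N) 1 / pivot j) * tau <= 1 ->
  riccati 0 <= tau^-1.
Proof.
move=> H; have t0 : 0 < tau by have := tau_ge; have : 0 <= N%:R :> R by []; lra.
have z0 := ratio_gt0 0.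
have h := overshoot_gt0.
rewrite /riccati /gap mulr0 !subr0.
have key : (c - 1) * tau * ratio 0 <= c.
  rewrite -(ler_pM2l h) /ratio.
  have -> : (1 + 2 * N%:R * (c - 1)) * ((c - 1) * tau *
      (1 / (1 + 2 * N%:R * (c - 1)) + \sum_(0 <= j < N) 1 / pivot j))
    = (c - 1) * tau + (1 + 2 * N%:R * (c - 1)) * (c - 1) *
      (\sum_(0 <= j < N) 1 / pivot j) * tau.
    by field; rewrite gt_eqF.
  have -> : (1 + 2 * N%:R * (c - 1)) * c = (c - 1) * tau + 1 by rewrite /tau; ring.
  by rewrite lerD2l.
rewrite -subr_ge0.
have -> : tau^-1 - c / tau ^+ 2 * (tau - 1 / ratio 0)
  = (c - (c - 1) * tau * ratio 0) / (tau ^+ 2 * ratio 0).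
  by field; rewrite !gt_eqF.
by apply: divr_ge0; [rewrite subr_ge0 | rewrite mulr_ge0 ?exprn_ge0 ?ltW].
Qed.

Lemma sum_src : \sum_(0 <= k < N) src k = chain N.
Proof.
transitivity (chain N - chain 0); last by rewrite chain0 subr0.
rewrite -telescope_sumr //.
by apply: eq_big_nat => k /andP[_ kN]; rewrite chainS // addrC addKr.
Qed.

(** The case h = 1 in one coordinate: [y] is the gradient at x_sigma and [m] the weighted mean
    gradient. *)
Lemma quadratic_form_ge (g : nat -> R) (y : R) :
  let G k := \sum_(0 <= i < k) g i in
  let m := \sum_(0 <= k < N) src k * g k + (1 - chain N) * y in
  riccati 0 <= tau^-1 ->
  tau * m ^+ 2 <=
  \sum_(0 <= k < N) (src k * (2 * g k * G k + g k ^+ 2)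
                     + (chain k + chain k.+1) * g k ^+ 2)
  + y ^+ 2 + 2 * y * G N * (c - chain N).
Proof.
move=> G m ric0.
pose Z k := G k + gap k * y - tau * m.
have G0 : G 0%N = 0 by rewrite /G big_geq.
have GS k : G k.+1 = G k + g k by rewrite /G big_nat_recr.
have t0 : 0 < tau by have := tau_ge; have : 0 <= N%:R :> R by []; lra.
have Z0 : Z 0%N = tau * (y - m) by rewrite /Z G0 /gap; ring.
(* The first term telescopes the squares, the second the products of [y] with the partial sums. At
   [N] only the second survives, as [riccati N = 0]. *)
pose T k := riccati k * Z k ^+ 2 - 2 * y * ((c - chain k) * G k).
have step k : (0 <= k < N)%N ->
    (T k.+1 - T k) + 2 * tau * m * (src k * g k) - 2 * tau * m * y * src k
    + 2 * c * y ^+ 2 <=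
    src k * (2 * g k * G k + g k ^+ 2) + (chain k + chain k.+1) * g k ^+ 2.
  move=> /andP[_ kN]; have := riccati_step (Z k) (Z k.+1) kN.
  (* With divisions eliminated this way, the slack of [step] equals that of [riccati_step] as a
     polynomial. *)
  have sp : chain k = src k * gap k - src k - c.
    have := gap_gt0 (ltnW kN); have := gap_gt0 kN.
    rewrite /chain /src gapS => p1 p0.
    have -> : tau = gap k + k%:R by rewrite /gap; ring.
    by field; rewrite !gt_eqF.
  rewrite /T; move: (riccati k.+1) (riccati k) => r1 r0.
  have -> : Z k.+1 = Z k + g k - y by rewrite /Z GS gapS; ring.
  have -> : G k = Z k - gap k * y + tau * m by rewrite /Z; ring.
  rewrite GS; have -> : G k = Z k - gap k * y + tau * m by rewrite /Z; ring.
  rewrite chainS // sp -subr_ge0 => H; rewrite -subr_ge0.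
  by apply: le_trans H _; rewrite le_eqVlt; apply/orP; left; apply/eqP; ring.
have := ler_sum_nat step.
rewrite 3!big_split /= telescope_sumr // sumrN.
rewrite -[X in _ + X - _ + _]mulr_sumr -[X in _ - X + _]mulr_sumr sum_src.
rewrite sumr_const_nat subn0 -[_ *+ N]mulr_natr.
have -> : \sum_(0 <= k < N) src k * g k = m - (1 - chain N) * y by rewrite /m; ring.
have TN : T N = - (2 * y * ((c - chain N) * G N)).
  by rewrite /T riccatiN mul0r sub0r.
have T0 : T 0%N <= tau * (y - m) ^+ 2.
  rewrite /T G0 !mulr0 subr0 Z0.
  have -> : tau * (y - m) ^+ 2 = tau^-1 * (tau * (y - m)) ^+ 2.
    by field; rewrite gt_eqF.
  by apply: ler_wpM2r; rewrite ?sqr_ge0.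
rewrite TN => H.
have tE : tau * y ^+ 2 = 2 * N%:R * c * y ^+ 2 + y ^+ 2 by rewrite /tau; ring.
lra.
Qed.

Lemma chain_ge0 k : (k <= N)%N -> 0 <= chain k.
Proof.
move=> /gap_gt0 p0; rewrite /chain divr_ge0 ?(ltW p0) // mulr_ge0 //.
exact: le_trans ler01 c_ge1.
Qed.

Lemma src_ge0 k : (k < N)%N -> 0 <= src k.
Proof.
move=> kN; have p0 := gap_gt0 (ltnW kN); have p1 := gap_gt0 kN.
rewrite /src divr_ge0 ?mulr_ge0 ?(ltW p0) ?(ltW p1) ?(le_trans ler01) //.
by apply: le_trans tau_ge; rewrite lerDr mulr_ge0.
Qed.

Lemma chain_le1 : chain N <= 1.
Proof.
have p0 := gap_gt0 (leqnn N); rewrite /chain ler_pdivrMr // mul1r /gap /tau.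
have : 0 <= N%:R * (c - 1) by rewrite mulr_ge0 ?subr_ge0.
lra.
Qed.

Lemma sum_pivot_le :
  2 * N%:R * ((\sum_(0 <= j < N) 1 / pivot j) * tau) <=
  (2 * N%:R + 1) * \sum_(0 <= j < N) j.+1%:R^-1.
Proof.
rewrite mulr_suml !mulr_sumr; apply: ler_sum_nat => k /andP[_ kN].
have q0 := pivot_gt0 kN; have := pivot_ge kN.
have k0 : 0 < k.+1%:R :> R by rewrite ltr0n.
rewrite natr1 => H; rewrite ler_pdivlMr // div1r.
have -> : 2 * N%:R * ((pivot k)^-1 * tau) * k.+1%:R
  = 2 * N%:R * k.+1%:R * tau / pivot k by ring.
by rewrite ler_pdivrMr.
Qed.

(** Summation by parts, [src] being the increment of [chain]. It makes the weighted interpolation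
    inequalities bound the last function value alone. *)
Lemma chain_abel (F : nat -> R) :
  \sum_(0 <= k < N) src k * F k + (1 - chain N) * F N
  + \sum_(0 <= k < N) chain k.+1 * (F k.+1 - F k) = F N.
Proof.
have : \sum_(0 <= k < N) (src k * F k + chain k.+1 * (F k.+1 - F k)) = chain N * F N.
  transitivity (\sum_(0 <= k < N) (chain k.+1 * F k.+1 - chain k * F k)).
    by apply: eq_big_nat => k /andP[_ kN]; rewrite chainS //; ring.
  by rewrite (telescope_sumr (fun k => chain k * F k)) // chain0 mul0r subr0.
rewrite big_split /= => E.
by rewrite addrAC E; ring.
Qed.

(** Jensen's inequality, as nonnegativity of the variance around [m]; the weights sum to 1 by
    [sum_src]. *)
Lemma sqr_mean_le (v : nat -> R) (y : R) :
  (\sum_(0 <= k < N) src k * v k + (1 - chain N) * y) ^+ 2 <=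
  \sum_(0 <= k < N) src k * v k ^+ 2 + (1 - chain N) * y ^+ 2.
Proof.
set m := _ + _.
have : 0 <= \sum_(0 <= k < N) src k * (v k - m) ^+ 2.
  rewrite big_nat_cond; apply: sumr_ge0 => k /andP[/andP[_ kN] _].
  by rewrite mulr_ge0 ?sqr_ge0 // src_ge0.
have -> : \sum_(0 <= k < N) src k * (v k - m) ^+ 2 =
    \sum_(0 <= k < N) src k * v k ^+ 2 - 2 * m * (m - (1 - chain N) * y)
    + m ^+ 2 * chain N.
  have -> : m - (1 - chain N) * y = \sum_(0 <= k < N) src k * v k by rewrite /m addrK.
  rewrite -sum_src !mulr_sumr -sumrB -big_split /=.
  by apply: eq_bigr => k _; ring.
have : 0 <= (1 - chain N) * (y - m) ^+ 2.
  by rewrite mulr_ge0 ?sqr_ge0 // subr_ge0 chain_le1.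
lra.
Qed.

End Multipliers.

(** One coordinate of the weighted sum: [X] stands for x_0 - xstar, [v] for the gradients over L,
    and [h * G k] for x_0 - x_k. The last chain term stands apart because the final point is
    x_sigma, at [h * c * G N] from x_0. *)
Lemma weighted_bound (R : realFieldType) (M : nat) (c h X : R) (v : nat -> R) :
  let N := M.+1 in
  let G k := \sum_(0 <= i < k) v i in
  1 <= c -> 0 <= h -> h <= 1 -> riccati N c 0 <= (tau N c)^-1 ->
  \sum_(0 <= k < N) src N c k * (v k * (X - h * G k) - v k ^+ 2 / 2)
  + (1 - chain N c N) * (v N * (X - h * c * G N) - v N ^+ 2 / 2)
  - \sum_(0 <= k < M) chain N c k.+1 *
      (v k.+1 * (h * v k) + (v k - v k.+1) ^+ 2 / 2)
  - chain N c N * (v N * (h * (c * G N - G M)) + (v M - v N) ^+ 2 / 2)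
  <= X ^+ 2 / (2 * (2 * N%:R * h * c + 1)).
Proof.
move=> N G c1 h0 h1 ric0.
have := quadratic_form_ge c1 v (v N) ric0.
have := sqr_mean_le N c1 v (v N).
set A := chain N c N; set m := _ + (1 - A) * v N => Jensen.
rewrite -/(G N) => RR.
pose S2 := \sum_(0 <= k < N) src N c k * (v k * G k).
pose S3 := \sum_(0 <= k < N) src N c k * v k ^+ 2.
pose C1 := \sum_(0 <= k < M) chain N c k.+1 * v k ^+ 2.
pose C2 := \sum_(0 <= k < M) chain N c k.+1 * v k.+1 ^+ 2.
pose C3 := \sum_(0 <= k < M) chain N c k.+1 * (v k * v k.+1).
have E1 : \sum_(0 <= k < N) (src N c k * (2 * v k * G k + v k ^+ 2)
      + (chain N c k + chain N c k.+1) * v k ^+ 2)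
    = 2 * S2 + S3 + C1 + C2 + A * v M ^+ 2.
  have -> : C2 = \sum_(0 <= k < N) chain N c k * v k ^+ 2.
    by rewrite big_nat_recl // chain0 mul0r add0r.
  have -> : C1 = \sum_(0 <= k < N) chain N c k.+1 * v k ^+ 2 - A * v M ^+ 2.
    by rewrite big_nat_recr //= addrK.
  transitivity (2 * S2 + S3 + (\sum_(0 <= k < N) chain N c k * v k ^+ 2
      + \sum_(0 <= k < N) chain N c k.+1 * v k ^+ 2)); last by ring.
  rewrite /S2 /S3 mulr_sumr -!big_split /=.
  by apply: eq_bigr => k _; ring.
have E2 : \sum_(0 <= k < N) src N c k * (v k * (X - h * G k) - v k ^+ 2 / 2)
    = X * (m - (1 - A) * v N) - h * S2 - S3 / 2.
  have -> : m - (1 - A) * v N = \sum_(0 <= k < N) src N c k * v k by rewrite /m addrK.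
  rewrite /S2 /S3 mulr_sumr mulr_sumr mulr_suml -!sumrB.
  by apply: eq_bigr => k _; ring.
have E3 : \sum_(0 <= k < M) chain N c k.+1 *
      (v k.+1 * (h * v k) + (v k - v k.+1) ^+ 2 / 2)
    = h * C3 + (C1 + C2) / 2 - C3.
  rewrite /C1 /C2 -big_split mulr_suml /C3 mulr_sumr -big_split -sumrB /=.
  by apply: eq_bigr => k _; field.
have C_ge0 : 0 <= C1 + C2 - 2 * C3.
  rewrite /C1 /C2 /C3 mulr_sumr -big_split -sumrB /= big_nat_cond.
  apply: sumr_ge0 => k /andP[/andP[_ kM] _].
  have -> : chain N c k.+1 * v k ^+ 2 + chain N c k.+1 * v k.+1 ^+ 2
      - 2 * (chain N c k.+1 * (v k * v k.+1))
    = chain N c k.+1 * (v k - v k.+1) ^+ 2 by ring.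
  by rewrite mulr_ge0 ?sqr_ge0 // chain_ge0 // ltnS ltnW.
have A_ge0 : 0 <= A by apply: chain_ge0.
have GN : G N = G M + v M by rewrite /G big_nat_recr.
have D_ge0 : 0 <= A * (v M - v N) ^+ 2 by rewrite mulr_ge0 ?sqr_ge0.
move: Jensen RR; rewrite E1 E2 E3 -/S3 => Jensen RR.
set T := 2 * N%:R * h * c + 1.
(* The curvature [T] is the mixture of the cases h = 1 and h = 0; [K1] and [K2] weight their
   inequalities accordingly. *)
have TE : T = h * tau N c + (1 - h) by rewrite /T /tau; ring.
have T0 : 0 < T.
  by rewrite /T ltr_pwDr // !mulr_ge0 // (le_trans ler01).
(* The right side is the maximum over [m] of the concave quadratic on the left. *)
have sq : X * m - T / 2 * m ^+ 2 <= X ^+ 2 / (2 * T).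
  rewrite -subr_ge0.
  have -> : X ^+ 2 / (2 * T) - (X * m - T / 2 * m ^+ 2) = (X - T * m) ^+ 2 / (2 * T).
    by field; rewrite gt_eqF.
  by rewrite divr_ge0 ?sqr_ge0 // mulr_ge0 // ltW.
apply: le_trans sq; rewrite TE.
have K1 : h * (tau N c * m ^+ 2) <=
   h * (2 * S2 + S3 + C1 + C2 + A * v M ^+ 2 + v N ^+ 2 + 2 * v N * G N * (c - A)).
  exact: ler_wpM2l.
have K2 : (1 - h) * m ^+ 2 <= (1 - h) * (S3 + (1 - A) * v N ^+ 2 + (C1 + C2 - 2 * C3)
     + A * (v M - v N) ^+ 2).
  by apply: ler_wpM2l; lra.
rewrite GN in K1 *; lra.
Qed.

(** * Monotonicity from the derivative, and the Euclidean inner product *)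

Lemma derive_le0_le (R : realType) (phi dphi : R -> R) (a b : R) :
  a < b ->
  (forall t, a <= t <= b -> is_derive t 1 phi (dphi t)) ->
  (forall t, a < t < b -> dphi t <= 0) ->
  phi b <= phi a.
Proof.
move=> ab dphiP dphi_le0.
have [||t tab] := @MVT R phi dphi a b ab.
- by move=> t; rewrite in_itv /= => /andP[at_ tb]; apply: dphiP; rewrite !ltW.
- apply: derivable_within_continuous => t; rewrite in_itv /= => tab.
  by have [] := dphiP t tab.
rewrite -subr_le0 => ->; rewrite in_itv /= in tab.
by rewrite mulr_le0_ge0 ?dphi_le0 // subr_ge0 ltW.
Qed.

Section InnerProduct.
Variables (R : realType) (d : nat).
Implicit Types u v w : 'rV[R]_d.

Definition dot u v : R := \sum_(i < d) u 0 i * v 0 i.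

Lemma enorm_sqr u : enorm u ^+ 2 = dot u u.
Proof.
rewrite /enorm sqr_sqrtr; last by apply: sumr_ge0 => i _; exact: sqr_ge0.
by apply: eq_bigr.
Qed.

Lemma dot_ge0 u : 0 <= dot u u.
Proof. by apply: sumr_ge0 => i _; rewrite -expr2 sqr_ge0. Qed.

Lemma dotDr u v w : dot u (v + w) = dot u v + dot u w.
Proof. by rewrite -big_split; apply: eq_bigr => i _; rewrite mxE mulrDr. Qed.

Lemma dotZr a u v : dot u (a *: v) = a * dot u v.
Proof. by rewrite mulr_sumr; apply: eq_bigr => i _; rewrite mxE mulrCA. Qed.

Lemma dotNr u v : dot u (- v) = - dot u v.
Proof. by rewrite -scaleN1r dotZr mulN1r. Qed.

Lemma dotC u v : dot u v = dot v u.
Proof. by apply: eq_bigr => i _; rewrite mulrC. Qed.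

Lemma dot_eq0 u : dot u u = 0 -> u = 0.
Proof.
move=> /eqP; rewrite psumr_eq0 => [|i _]; last by rewrite -expr2 sqr_ge0.
move=> /allP u0; apply/rowP => i; apply/eqP; rewrite mxE.
by have := u0 i (mem_index_enum i); rewrite mulf_eq0 orbb.
Qed.

Lemma dotZ_sqr a u : dot (a *: u) (a *: u) = a ^+ 2 * dot u u.
Proof. by rewrite dotZr dotC dotZr mulrA -expr2. Qed.

(** Expanding the square of [u - K *: v] takes the place of Cauchy-Schwarz and keeps square roots
    out. *)
Lemma dot_le_of_sqr_le (K : R) u v :
  0 < K -> dot u u <= K ^+ 2 * dot v v -> dot u v <= K * dot v v.
Proof.
move=> K0 uv; have := dot_ge0 (u - K *: v).
rewrite dotDr dotNr dotZr (dotC _ u) (dotC _ v) !dotDr !dotNr !dotZr (dotC v u).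
by move=> h; rewrite -(ler_pM2l K0); lra.
Qed.

End InnerProduct.

(** * Smooth convex functions: quadratic bounds and the interpolation inequality *)

Section Smooth.
Variables (R : realType) (d : nat) (L : R) (f : 'rV[R]_d -> R).
Hypothesis L_gt0 : 0 < L.
Hypothesis f_smooth : smooth L f.
Implicit Types x y v : 'rV[R]_d.

Lemma derive_dot x v : 'D_v f x = dot (grad f x) v.
Proof.
have df : differentiable f x by case: f_smooth.
rewrite deriveE // {1}(row_sum_delta v) linear_sum /=; apply: eq_bigr => i _.
by rewrite linearZ /= -deriveE // mxE mulrC.
Qed.

Lemma is_derive_line x v (t : R) :
  is_derive t 1 (fun s : R => f (x + s *: v)) (dot (grad f (x + t *: v)) v).
Proof.
have df : differentiable f (x + t *: v) by case: f_smooth.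
have dv := diff_derivable (v := v) df.
(* The difference quotient along the line is that of the directional derivative at [x + t *: v]. *)
have E : (fun h : R => h^-1 *: (f (x + (h *: (1 : R) + t) *: v) - f (x + t *: v)))
  = (fun h : R => h^-1 *: (f (h *: v + (x + t *: v)) - f (x + t *: v))).
  apply/funext => h; congr (_ *: (f _ - _)).
  by rewrite /= [h *: 1]mulr1 scalerDl addrCA.
split; first by rewrite /derivable /= E.
by rewrite -derive_dot /derive /= E.
Qed.

Lemma smooth_dot x y :
  dot (grad f x - grad f y) (grad f x - grad f y) <=
  L ^+ 2 * dot (x - y) (x - y).
Proof.
rewrite -!enorm_sqr -exprMn ler_pXn2r ?nnegrE ?mulr_ge0 ?sqrtr_ge0 ?(ltW L_gt0) //.
by case: f_smooth.
Qed.

(* The sign [s] gives the upper and the lower quadratic bound at once. *)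
Lemma descent (s : R) x v : s ^+ 2 = 1 ->
  s * (f (x + v) - f x - dot (grad f x) v) <= L / 2 * dot v v.
Proof.
move=> s1; set g := dot (grad f x) v.
pose phi (t : R) := s * (f (x + t *: v) - t * g) - L / 2 * dot v v * t ^+ 2.
pose dphi (t : R) :=
  s * (dot (grad f (x + t *: v)) v - g) - L * dot v v * t.
(* [phi] is nonincreasing on [0, 1]: the Lipschitz bound at distance t |v| controls the sign of
   [dphi]. *)
suff : phi 1 <= phi 0.
  by rewrite /phi scale1r scale0r addr0; lra.
apply: (@derive_le0_le _ phi dphi) => // t /andP[t0 t1].
  have df := is_derive_line x v t.
  rewrite /phi; apply: is_derive_eq.
  rewrite /dphi /GRing.scale /= [g]lock [dot v v]lock.
  by field.
rewrite /dphi subr_le0.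
set w := grad f (x + t *: v) - grad f x.
have -> : dot (grad f (x + t *: v)) v - g = dot w v.
  by rewrite /g ![dot _ v]dotC dotDr dotNr.
have -> : s * dot w v = dot (s *: w) v by rewrite [RHS]dotC dotZr dotC.
rewrite [L * _ * t]mulrAC; apply: dot_le_of_sqr_le; first exact: mulr_gt0.
rewrite dotZ_sqr s1 mul1r.
apply: le_trans (smooth_dot _ _) _.
by rewrite addrAC subrr add0r dotZ_sqr exprMn; lra.
Qed.

(** If the tangent exceeded f by [del], convexity would put f at [x + t *: v] at least [t * del]
    below the tangent, while [descent] with sign -1 allows only [t ^+ 2 * B]. *)
Lemma convex_ge_tangent x v : convex_function setT f ->
  f x + dot (grad f x) v <= f (x + v).
Proof.
move=> cf; rewrite leNgt; apply/negP => lt.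
pose B := L / 2 * dot v v.
pose del := f x + dot (grad f x) v - f (x + v).
have del0 : 0 < del by rewrite /del subr_gt0.
have B0 : 0 <= B by rewrite mulr_ge0 ?dot_ge0 // divr_ge0 // ltW.
have den : 0 < del + B by lra.
(* Any [t] in (0, 1] with [t * B < del] gives the contradiction; this one also covers [B = 0]. *)
pose t := del / (del + B).
have t0 : 0 < t by rewrite divr_gt0.
have t1 : t <= 1 by rewrite ler_pdivrMr // mul1r; lra.
have := cf (Itv01 (ltW t0) t1) (x + v) x (in_setT _) (in_setT _).
rewrite convRE /=.
have -> : (conv (Itv01 (ltW t0) t1) (x + v : convex_lmodType _)
    (x : convex_lmodType _))
   = x + t *: v :> 'rV[R]_d.
  rewrite /conv /= /unstable.onem scalerDr scalerBl scale1r [in LHS]addrC.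
  by rewrite addrA subrK.
rewrite /unstable.onem => C.
have sq1 : (-1) ^+ 2 = 1 :> R by rewrite sqrrN expr1n.
have := descent x (t *: v) sq1.
rewrite dotZ_sqr dotZr => Dn.
have tB : t * (del - t * B) <= 0 by rewrite /B /del; lra.
have : del - t * B <= 0 by rewrite -(pmulr_rle0 _ t0).
have : t * B < del.
  by rewrite /t mulrAC ltr_pdivrMr // ltr_pM2l //; lra.
lra.
Qed.

(** The value of f at [x - L^-1 *: w] is bounded below by the tangent at [y] and above by [descent]
    from [x]; comparing the two gives the squared gradient difference. *)
Lemma interpolation x y : convex_function setT f ->
  f y + dot (grad f y) (x - y)
  + dot (grad f x - grad f y) (grad f x - grad f y) / (2 * L) <= f x.
Proof.
move=> cf; set w := grad f x - grad f y.
have L0 : L != 0 by rewrite gt_eqF.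
have := descent x (- L^-1 *: w) (expr1n R 2).
have := convex_ge_tangent y (x - y - L^-1 *: w) cf.
have -> : y + (x - y - L^-1 *: w) = x - L^-1 *: w.
  by rewrite addrA addrA [y + x]addrC addrK.
rewrite dotZ_sqr dotDr -scaleNr !dotZr scaleNr => H1 H2.
have Hw : dot (grad f x) w = dot w w + dot (grad f y) w.
  by rewrite !(dotC _ w) -dotDr /w subrK.
rewrite Hw in H2.
have E : L / 2 * ((- L^-1) ^+ 2 * dot w w) = L^-1 * dot w w / 2 by field.
have E2 : dot w w / (2 * L) = L^-1 * dot w w / 2 by field.
rewrite E2; lra.
Qed.

(** A gradient step of length 1/L would lower f by |grad f x|^2 / (2 L). *)
Lemma grad_minimizer x : is_minimizer f x -> grad f x = 0.
Proof.
move=> xmin; apply: dot_eq0; apply/eqP; rewrite eq_le dot_ge0 andbT.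
have := descent x (- L^-1 *: grad f x) (expr1n R 2).
have := xmin (x - L^-1 *: grad f x).
rewrite dotZ_sqr dotZr scaleNr.
move: (dot _ _) => D H1 H2.
have E : L / 2 * ((- L^-1) ^+ 2 * D) = L^-1 * D / 2 by field; rewrite gt_eqF.
by rewrite -(pmulr_rle0 _ (_ : 0 < L^-1)) ?invr_gt0 //; lra.
Qed.

End Smooth.

(** * Harmonic numbers, the logarithm and the Euler-Mascheroni constant *)

Section Harmonic.
Variable R : realType.

(** The difference of the sides has derivative -(1 - 1/t)^2 / 2. At x = 1 + 1/n the right side is
    the trapezoid value (1/n + 1/(n+1)) / 2. *)
Lemma ln_le_trapezoid (x : R) : 1 <= x -> ln x <= (x - x^-1) / 2.
Proof.
rewrite le_eqVlt => /predU1P[<-|x1]; first by rewrite ln1 invr1 subrr mul0r.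
have x0 : 0 < x by lra.
pose phi (t : R) := ln t - (t - t^-1) / 2.
have dphi (t : R) : 1 <= t -> is_derive t 1 phi (t^-1 - (1 + t ^- 2) / 2).
  move=> t1; have t0 : 0 < t by lra.
  have dln := is_derive1_ln t0.
  have dinv := @is_deriveV R id t 1 1 (lt0r_neq0 t0) (is_derive_id _ _).
  have -> : phi = @ln R \- 2^-1 \*: (id \- (fun y => (id y)^-1)).
    by apply/funext => y; rewrite /phi /= mulrC.
  apply: is_derive_eq.
  by rewrite /GRing.scale /=; field; rewrite gt_eqF.
suff : phi x <= phi 1 by rewrite /phi ln1 invr1; lra.
apply: (derive_le0_le x1) => t /andP[t1 _]; first exact: dphi.
have t0 : 0 < t by lra.
have -> : t^-1 - (1 + t ^- 2) / 2 = - (1 - t^-1) ^+ 2 / 2.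
  by field; rewrite gt_eqF.
by rewrite mulNr oppr_le0 divr_ge0 ?sqr_ge0.
Qed.

Lemma ln_ge_1BV (x : R) : 0 < x -> 1 - x^-1 <= ln x.
Proof.
move=> x0; have xV : 0 < x^-1 by rewrite invr_gt0.
have := @le_ln1Dx R (x^-1 - 1).
rewrite [1 + _]addrC subrK lnV ?posrE // => H.
have : - ln x <= x^-1 - 1 by apply: H; lra.
lra.
Qed.

Lemma series_harmonicS n :
  series (@harmonic R) n.+1 = series (@harmonic R) n + n.+1%:R^-1.
Proof. by rewrite /series /= big_nat_recr. Qed.

Lemma ln_natS n : (0 < n)%N ->
  ln (n.+1%:R : R) - ln (n%:R : R) = ln (1 + n%:R^-1 : R).
Proof.
move=> n0; have n0' : 0 < n%:R :> R by rewrite ltr0n.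
rewrite -ln_div ?posrE ?ltr0Sn // -natr1 mulrDl divff ?gt_eqF //.
by rewrite mul1r.
Qed.

Lemma invS_le_ln_natS n : (0 < n)%N ->
  n.+1%:R^-1 <= ln n.+1%:R - ln n%:R :> R.
Proof.
move=> n0; have n0' : 0 < n%:R :> R by rewrite ltr0n.
have x0 : 0 < 1 + n%:R^-1 :> R by rewrite addr_gt0 // invr_gt0.
rewrite ln_natS //; apply: le_trans (ln_ge_1BV x0).
rewrite le_eqVlt -natr1; apply/orP; left; apply/eqP.
by field; rewrite !gt_eqF // addr_gt0.
Qed.

Lemma harmonic_ln_decr n : (0 < n)%N ->
  series (@harmonic R) n.+1 - ln n.+1%:R <= series (@harmonic R) n - ln n%:R.
Proof.
move=> /invS_le_ln_natS; rewrite series_harmonicS.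
by move: (n.+1%:R^-1) (ln n.+1%:R) => a b; lra.
Qed.

Lemma harmonic_ln_trapezoid_incr n : (0 < n)%N ->
  series (@harmonic R) n - ln n%:R - (2 * n%:R)^-1 <=
  series (@harmonic R) n.+1 - ln n.+1%:R - (2 * n.+1%:R)^-1.
Proof.
move=> n0; have n0' : 0 < n%:R :> R by rewrite ltr0n.
have x1 : 1 <= 1 + n%:R^-1 :> R by rewrite lerDl invr_ge0.
have := ln_le_trapezoid x1; rewrite -(ln_natS n0) series_harmonicS.
have -> : (1 + n%:R^-1 - (1 + n%:R^-1)^-1) / 2
  = (2 * n%:R)^-1 + n.+1%:R^-1 - (2 * n.+1%:R)^-1 :> R.
  by rewrite -natr1; field; rewrite !gt_eqF // ?addr_gt0.
by move: (n.+1%:R^-1) (ln n.+1%:R) ((2 * _)^-1) ((2 * _)^-1) => a b p q; lra.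
Qed.

Lemma series_harmonic_le_ln n : (0 < n)%N ->
  series (@harmonic R) n <= 1 + ln n%:R.
Proof.
elim: n => // -[_ _|n /(_ isT) IH _]; last first.
  by have := harmonic_ln_decr (ltn0Sn n); lra.
by rewrite /series /= big_nat1 invr1 ln1 addr0.
Qed.

(** H_n - ln n decreases to its limit gamma, while H_n - ln n - 1/(2n) increases and stays below it,
    hence is at most gamma. *)
Lemma series_harmonic_le_euler n : (0 < n)%N ->
  series (@harmonic R) n <= ln n%:R + 1 / (2 * n%:R) + euler_mascheroni R.
Proof.
case: n => // n _.
(* The index is shifted by one because both monotonicity lemmas start at 1. *)
pose u k : R := series (@harmonic R) k.+1 - ln k.+1%:R.
pose v k : R := u k - (2 * k.+1%:R)^-1.
have v_incr : nondecreasing_seq v.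
  by apply/nondecreasing_seqP => k; exact: harmonic_ln_trapezoid_incr.
have vu k : v k <= u k by rewrite lerBlDr lerDl invr_ge0 mulr_ge0.
have cu : cvgn u.
  apply: nonincreasing_is_cvgn.
    by apply/nonincreasing_seqP => k; exact: harmonic_ln_decr.
  exists (v 0%N) => _ [k _ <-]; exact: le_trans (v_incr _ _ (leq0n k)) (vu k).
have eul : euler_mascheroni R = limn u.
  rewrite /euler_mascheroni; apply: cvg_lim => //.
  by rewrite -cvg_shiftS.
have : v n <= limn u.
  apply: limr_ge => //; near=> k; apply: le_trans (vu k); apply: v_incr.
  by near: k; exact: nbhs_infty_ge.
rewrite eul div1r; move: (limn u) => l.
rewrite /v /u; move: (ln _) ((2 * _)^-1) => a b; lra.
Unshelve. all: by end_near. Qed.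

(** ln 2 = ln 8 - ln 4 is at least 1/5 + 1/6 + 1/7 + 1/8. *)
Lemma ln2_ge : 63 / 100 <= ln (2 : R).
Proof.
have h4 := invS_le_ln_natS (isT : 0 < 4)%N.
have h5 := invS_le_ln_natS (isT : 0 < 5)%N.
have h6 := invS_le_ln_natS (isT : 0 < 6)%N.
have h7 := invS_le_ln_natS (isT : 0 < 7)%N.
have l4 : ln (4 : R) = 2 * ln 2.
  have -> : 4 = 2 ^+ 2 :> R by ring.
  by rewrite lnXn // -[_ *+ _]mulr_natr; ring.
have l8 : ln (8 : R) = 3 * ln 2.
  have -> : 8 = 2 ^+ 3 :> R by ring.
  by rewrite lnXn // -[_ *+ _]mulr_natr; ring.
rewrite l4 in h4; rewrite l8 in h7.
move: (ln 5) (ln 6) (ln 7) (ln 2) h4 h5 h6 h7 => a b c d; lra.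
Qed.

Lemma ln_le_half (x : R) : 0 < x -> ln x <= x / 2.
Proof.
move=> x0; have x20 : 0 < x / 2 by rewrite divr_gt0.
have : ln (x / 2) <= x / 2 - 1.
  by have := @le_ln1Dx R (x / 2 - 1); rewrite [1 + _]addrC subrK; apply; lra.
have : ln (2 : R) <= 1.
  by have := @le_ln1Dx R 1; apply; lra.
rewrite ln_div ?posrE //; lra.
Qed.

End Harmonic.

(** * Assembling the coordinates into the rate for a general factor c *)

Lemma extrapolated_rate (R : realType) (d : nat) (L : R) (M : nat) (h c : R)
    (f : 'rV[R]_d -> R) (xstar : 'rV[R]_d) (x : nat -> 'rV[R]_d) :
  let N := M.+1 in
  0 < L -> 0 <= h -> h <= 1 -> 1 <= c ->
  ((c - 1) + 2 * N%:R * (c - 1) ^+ 2) * (2 * N%:R + 1) * series (@harmonic R) N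
    <= 2 * N%:R ->
  convex_function setT f -> smooth L f -> is_minimizer f xstar ->
  gradient_descent L f N (fun=> h) x ->
  f (x 0%N + c *: (x N - x 0%N)) - f xstar <=
    L * enorm (x 0%N - xstar) ^+ 2 / (2 * (2 * N%:R * h * c + 1)).
Proof.
move=> N L0 h0 h1 c1 Hc cf sf xmin xgd.
have n0 : 0 < N%:R :> R by rewrite ltr0n.
have ric0 : riccati N c 0 <= (tau N c)^-1.
  apply: riccati0 => //.
  have H := sum_pivot_le N c1.
  have e0 : 0 <= (c - 1) + 2 * N%:R * (c - 1) ^+ 2.
    by apply: addr_ge0; rewrite ?subr_ge0 // mulr_ge0 ?sqr_ge0 // mulr_ge0.
  have HH := ler_wpM2l e0 H.
  rewrite -(ler_pM2l (_ : 0 < 2 * N%:R)) ?mulr_gt0 // mulr1.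
  move: HH Hc; rewrite /series /=.
  set Q := \sum_(0 <= j < N) 1 / _; set S := \sum_(0 <= j < N) _%:R^-1.
  move: Q S => Q S; lra.
set xs := x 0%N + _.
(* x_sigma takes the place of x_N. [a] and [b] are the coordinate shares of the interpolation
   inequalities for (xstar, p k) and (p k, p k.+1). *)
pose p k := if (k < N)%N then x k else xs.
pose v i k := L^-1 * grad f (p k) 0 i.
pose F k := f (p k) - f xstar.
pose a k i := v i k * ((p k) 0 i - xstar 0 i) - v i k ^+ 2 / 2.
pose b k i := v i k.+1 * ((p k) 0 i - (p k.+1) 0 i) + (v i k - v i k.+1) ^+ 2 / 2.
have Fa k : F k <= L * \sum_(i < d) a k i.
  have := interpolation L0 sf xstar (p k) cf.
  rewrite (grad_minimizer L0 sf xmin) sub0r dotNr (dotC (- _)) dotNr opprK.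
  have -> : L * \sum_(i < d) a k i
     = - dot (grad f (p k)) (xstar - p k) - dot (grad f (p k)) (grad f (p k)) / (2 * L).
    rewrite /dot mulr_sumr mulr_suml -sumrN -sumrB; apply: eq_bigr => i _.
    by rewrite /a /v !mxE; field; rewrite gt_eqF.
  by rewrite /F; lra.
have Fb k : F k.+1 - F k <= - (L * \sum_(i < d) b k i).
  have := interpolation L0 sf (p k) (p k.+1) cf.
  have -> : L * \sum_(i < d) b k i
     = dot (grad f (p k.+1)) (p k - p k.+1)
     + dot (grad f (p k) - grad f (p k.+1)) (grad f (p k) - grad f (p k.+1)) / (2 * L).
    rewrite /dot mulr_sumr mulr_suml -big_split /=; apply: eq_bigr => i _.
    by rewrite /b /v !mxE; field; rewrite gt_eqF.
  by rewrite /F; lra.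
have xE i k : (k <= N)%N -> x k 0 i = x 0%N 0 i - h * \sum_(0 <= j < k) v i j.
  elim: k => [_|k IH kN]; first by rewrite big_geq // mulr0 subr0.
  have vE : v i k = L^-1 * grad f (x k) 0 i by rewrite /v /p kN.
  rewrite big_nat_recr //= vE xgd //.
  by move: (grad f (x k)) => gk; rewrite !mxE IH ?(ltnW kN) //; ring.
(* Inner products split into coordinates without mixing, so the scalar bound applies to each
   coordinate. *)
have bound i :
  \sum_(0 <= k < N) src N c k * a k i + (1 - chain N c N) * a N i
  - \sum_(0 <= k < N) chain N c k.+1 * b k i
  <= (x 0%N 0 i - xstar 0 i) ^+ 2 / (2 * (2 * N%:R * h * c + 1)).
  apply: le_trans (weighted_bound (x 0%N 0 i - xstar 0 i) (v i) c1 h0 h1 ric0).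
  have xsE : (p N) 0 i = x 0%N 0 i - h * c * \sum_(0 <= j < N) v i j.
    by rewrite /p ltnn /xs !mxE (xE _ N) //; ring.
  rewrite le_eqVlt; apply/orP; left; apply/eqP.
  rewrite [\sum_(0 <= k < N) chain N c k.+1 * _]big_nat_recr //= opprD addrA.
  congr (_ + _ - _ - _).
  - apply: eq_big_nat => k /andP[_ kN].
    by rewrite /a {1}/p kN (xE _ k) ?(ltnW kN) //; ring.
  - by rewrite /a xsE; ring.
  - apply: eq_big_nat => k /andP[_ kM].
    have kN : (k < N)%N by rewrite ltnS ltnW.
    rewrite /b /p kN ltnS kM (xE _ k) ?(ltnW kN) // (xE _ k.+1) //.
    by rewrite big_nat_recr //=; ring.
  - by rewrite /b xsE {1}/p ltnSn (xE _ M) //; ring.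
have T0 : 0 < 2 * (2 * N%:R * h * c + 1).
  by rewrite mulr_gt0 // ltr_wpDl // !mulr_ge0 // (le_trans ler01).
have -> : f xs - f xstar = F N by rewrite /F /p ltnn.
(* [F N] is expanded into the weighted sum, so that [Fa] and [Fb] apply termwise with nonnegative
   weights. *)
rewrite -(chain_abel N c1 F) enorm_sqr.
have -> : L * dot (x 0%N - xstar) (x 0%N - xstar) / (2 * (2 * N%:R * h * c + 1))
  = L * \sum_(i < d) (x 0%N 0 i - xstar 0 i) ^+ 2 / (2 * (2 * N%:R * h * c + 1)).
  by rewrite -mulrA /dot -mulr_suml; congr (_ * (_ * _));
    apply: eq_bigr => i _; rewrite !mxE.
apply: le_trans (ler_wpM2l (ltW L0) (ler_sum _ (fun i _ => bound i))).
have -> : L * \sum_(i < d) (\sum_(0 <= k < N) src N c k * a k i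
      + (1 - chain N c N) * a N i - \sum_(0 <= k < N) chain N c k.+1 * b k i)
  = \sum_(0 <= k < N) src N c k * (L * \sum_(i < d) a k i)
    + (1 - chain N c N) * (L * \sum_(i < d) a N i)
    + \sum_(0 <= k < N) chain N c k.+1 * - (L * \sum_(i < d) b k i).
  rewrite sumrB big_split /= exchange_big [X in L * (_ - X)]exchange_big /=.
  rewrite mulrBr mulrDr; congr (_ + _ + _).
  - by rewrite mulr_sumr; apply: eq_bigr => k _; rewrite -mulr_sumr mulrCA.
  - by rewrite -mulr_sumr mulrCA.
  - rewrite mulr_sumr -sumrN; apply: eq_bigr => k _.
    by rewrite -mulr_sumr mulrCA mulrN.
apply: lerD; first apply: lerD.
- apply: ler_sum_nat => k /andP[_ kN].
  by apply: ler_wpM2l (Fa k); exact: src_ge0.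
- by apply: ler_wpM2l (Fa N); rewrite subr_ge0 chain_le1.
- apply: ler_sum_nat => k /andP[_ kN].
  by apply: ler_wpM2l (Fb k); exact: chain_ge0.
Qed.

(** * The two explicit extrapolation factors *)

Theorem corollary4p2 (R : realType) (d : nat) (L : R) (N : nat) (h : R)
    (f : 'rV[R]_d -> R) (xstar : 'rV[R]_d) (x : nat -> 'rV[R]_d)
    (d_ge1 : (1 <= d)%N) (L_gt0 : 0 < L) (N_gt1 : (1 < N)%N)
    (h_gt0 : 0 < h) (h_le1 : h <= 1)
    (f_convex : convex_function setT f) (f_smooth : smooth L f)
    (xstar_min : is_minimizer f xstar)
    (x_gd : gradient_descent L f N (fun=> h) x) :
  let D : R := enorm (x 0%N - xstar) in
  let n : R := N%:R in
  let ell : R := ln n + 1 / (2 * n) + euler_mascheroni R in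
  (let c : R := 1 - 1 / (4 * n)
       + Num.sqrt (1 / (16 * n ^+ 2) + 1 / ((2 * n + 1) * ell)) in
   let xsigma : 'rV[R]_d := x 0%N + c *: (x N - x 0%N) in
   f xsigma - f xstar <=
     L * D ^+ 2 /
       (4 * n * h
        + (Num.sqrt (1 + 16 * n ^+ 2 / ((2 * n + 1) * ell)) - 1) * h + 2))
  /\
  (let c : R := 1 + 1 / (4 * Num.sqrt (n * ln n)) in
   let xsigma : 'rV[R]_d := x 0%N + c *: (x N - x 0%N) in
   f xsigma - f xstar <=
     L * D ^+ 2 / (4 * n * h + Num.sqrt (n / ln n) * h + 2)).
Proof.
move=> D n ell.
have n2 : 2 <= n by rewrite ler_nat.
have n0 : 0 < n by lra.
have N0 : (0 < N)%N by apply: ltn_trans N_gt1.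
have rate c : 1 <= c ->
    ((c - 1) + 2 * n * (c - 1) ^+ 2) * (2 * n + 1) * series (@harmonic R) N
      <= 2 * n ->
    f (x 0%N + c *: (x N - x 0%N)) - f xstar <=
      L * D ^+ 2 / (2 * (2 * n * h * c + 1)).
  move=> c1 Hc; rewrite /D /n; move: N0 Hc x_gd; rewrite /n.
  by case: (N) => // M _ Hc gd; apply: extrapolated_rate => //; exact: ltW.
have H0 : 0 < series (@harmonic R) N.
  rewrite -(prednK N0) series_harmonicS ltr_wpDl ?invr_gt0 ?ltr0n //.
  by apply: sumr_ge0 => i _; exact: harmonic_ge0.
split.
- have Hell : series (@harmonic R) N <= ell by exact: series_harmonic_le_euler.
  have ell0 : 0 < ell by exact: lt_le_trans Hell.
  set A := 1 / (16 * n ^+ 2) + _ => c.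
  have n21 : 0 < 2 * n + 1 by lra.
  have A0 : 0 <= A.
    by rewrite addr_ge0 // divr_ge0 // mulr_ge0 ?sqr_ge0 // ltW.
  have s2 : Num.sqrt A ^+ 2 = A by rewrite sqr_sqrtr.
  have s_ge : 1 / (4 * n) <= Num.sqrt A.
    rewrite -(ler_pXn2r (n := 2)) ?nnegrE ?sqrtr_ge0 ?divr_ge0 ?mulr_ge0 ?(ltW n0) //.
    rewrite s2 /A.
    have -> : (1 / (4 * n)) ^+ 2 = 1 / (16 * n ^+ 2) by field; rewrite gt_eqF.
    by rewrite lerDl divr_ge0 // mulr_ge0 // ltW.
  have -> : Num.sqrt (1 + 16 * n ^+ 2 / ((2 * n + 1) * ell)) = 4 * n * Num.sqrt A.
    have -> : 1 + 16 * n ^+ 2 / ((2 * n + 1) * ell) = (4 * n * Num.sqrt A) ^+ 2.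
      by rewrite exprMn s2 /A; field; rewrite !gt_eqF.
    by rewrite sqrtr_sqr ger0_norm // !mulr_ge0 ?sqrtr_ge0 // ltW.
  have -> : 4 * n * h + (4 * n * Num.sqrt A - 1) * h + 2 = 2 * (2 * n * h * c + 1).
    by rewrite /c; field; rewrite gt_eqF.
  apply: rate; first by rewrite /c; lra.
  (* [c - 1] is the nonnegative root of this quadratic equation, that is, equality in the condition
     of [rate] with the harmonic number replaced by [ell]. *)
  have -> : c - 1 + 2 * n * (c - 1) ^+ 2 = 2 * n / ((2 * n + 1) * ell).
    have -> : c - 1 + 2 * n * (c - 1) ^+ 2
      = 2 * n * (Num.sqrt A ^+ 2 - 1 / (16 * n ^+ 2)).
      by rewrite /c; field; rewrite gt_eqF.
    by rewrite s2 /A; field; rewrite !gt_eqF.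
  have -> : 2 * n / ((2 * n + 1) * ell) * (2 * n + 1) * series (@harmonic R) N
    = 2 * n * (series (@harmonic R) N / ell) by field; rewrite !gt_eqF.
  by rewrite ler_piMr ?mulr_ge0 ?(ltW n0) // ler_pdivrMr // mul1r.
- have l_ge : 63 / 100 <= ln n by apply: le_trans (ln2_ge R) _; rewrite ler_ln ?posrE.
  have Hl : series (@harmonic R) N <= 1 + ln n by exact: series_harmonic_le_ln.
  have ln_half := ln_le_half n0.
  move: (ln n) l_ge Hl ln_half => l l_ge Hl ln_half.
  have l0 : 0 < l by lra.
  set q := Num.sqrt (n * l) => c.
  have q2 : q ^+ 2 = n * l by rewrite sqr_sqrtr // mulr_ge0 // ltW.
  have q0 : 0 < q by rewrite sqrtr_gt0 mulr_gt0.
  have -> : Num.sqrt (n / l) = n / q.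
    have -> : n / l = (n / q) ^+ 2.
      by rewrite expr_div_n q2; field; rewrite !gt_eqF.
    by rewrite sqrtr_sqr ger0_norm // divr_ge0 // ltW.
  have -> : 4 * n * h + n / q * h + 2 = 2 * (2 * n * h * c + 1).
    by rewrite /c; field; rewrite gt_eqF.
  apply: rate; first by rewrite /c lerDl divr_ge0 // mulr_ge0 // ltW.
  (* From l <= n/2 follows q^2 = n l >= 2 l^2, and 49/25 < 2. *)
  have ql : 7 / 5 * l <= q.
    rewrite -(ler_pXn2r (n := 2)) ?nnegrE ?mulr_ge0 ?(ltW q0) ?(ltW l0) //.
    rewrite q2 exprMn; have : l * l <= n / 2 * l by rewrite ler_pM2r.
    by have := sqr_ge0 l; lra.
  have -> : c - 1 + 2 * n * (c - 1) ^+ 2 = 1 / (4 * q) + 1 / (8 * l).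
    have -> : c - 1 + 2 * n * (c - 1) ^+ 2 = 1 / (4 * q) + n / (8 * q ^+ 2).
      by rewrite /c; field; rewrite gt_eqF.
    by rewrite q2; field; rewrite !gt_eqF.
  (* 17/56 = 5/28 + 1/8, the first part coming from [ql]. *)
  have e_le : 1 / (4 * q) + 1 / (8 * l) <= 17 / 56 / l.
    have -> : 17 / 56 / l = 1 / (4 * (7 / 5 * l)) + 1 / (8 * l).
      by field; rewrite gt_eqF.
    by rewrite lerD2r !div1r lef_pV2 ?posrE ?mulr_gt0 // ler_pM2l.
  have n_le : 2 * n + 1 <= 5 / 2 * n by lra.
  have e0 : 0 <= 1 / (4 * q) + 1 / (8 * l).
    by rewrite addr_ge0 // divr_ge0 // mulr_ge0 // ltW.
  apply: (@le_trans _ _ (17 / 56 / l * (5 / 2 * n) * (1 + l))).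
    by do 2 (apply: ler_pM => //; rewrite ?mulr_ge0 ?(ltW H0) //; try lra).
  have -> : 17 / 56 / l * (5 / 2 * n) * (1 + l) = 85 / 112 * n * ((1 + l) / l).
    by field; rewrite gt_eqF.
  (* 224/85 is 2 divided by 85/112; the bound amounts to l >= 85/139, which 63/100 exceeds. *)
  have : (1 + l) / l <= 224 / 85 by rewrite ler_pdivrMr //; lra.
  move=> /(ler_wpM2l (_ : 0 <= 85 / 112 * n)); lra.
Qed.
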